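(* Let $n\ge 1$. A function $f:[0,1]^n\to[0,1]$ can be implemented by a Bernoulli factory if and only if $f$ is continuous and both $f$ and $1-f$ are polynomially bounded.
   Context: A (multiparameter) Bernoulli factory with input $(p_1,\dots,p_n)$ is a (possibly infinite) rooted binary tree in which every node has either $2$ children (internal node) or $0$ children (leaf). Each internal node is labelled either by an index $i\in[n]=\{1,\dots,n\}$ or by a constant $c\in(0,1)$; each leaf is labelled $0$ or $1$. To execute it with coins $p=(p_1,\dots,p_n)\in[0,1]^n$, start at the root; at an internal node labelled $i$ draw a fresh independent Bernoulli($p_i$) sample (flip the $p_i$-coin), at a node labelled $c$ draw a fresh independent Bernoulli($c$) sample; move to the child corresponding to the outcome $0$ or $1$; upon reaching a leaf output its label. A function $f:D\to[0,1]$, $D\subseteq[0,1]^n$, is implementable by a Bernoulli factory if there is such a tree which, for every $p\in D$, reaches a leaf almost surely and outputs $1$ with probability exactly $f(p)$. Open faces: for a partition $[n]=A\sqcup S\sqcup B$, $F_{A,S,B}=\{p\in[0,1]^n: p_i=0\ (i\in A),\ 0<p_i<1\ (i\in S),\ p_i=1\ (i\in B)\}$. For $T\subseteq[n]$, $p^T=\prod_{i\in T}p_i$ and $(1-p)^T=\prod_{i\in T}(1-p_i)$ (empty products are $1$). For a set $X$, $f|_X\equiv 0$ means $f(p)=0$ for all $p\in X$. A function $f:[0,1]^n\to[0,1]$ is polynomially bounded if there exist an integer $m\ge 0$ and a real $c>0$ such that for every open face $F_{A,S,B}$: if $f|_{F_{A,S,B}}\not\equiv 0$, then $f(p)\ge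 c\left((1-p)^A\, p^S(1-p)^S\, p^B\right)^m$ for all $p\in[0,1]^n$. *)

(* Defs.v *)
From HB Require Import structures.
From mathcomp Require Import all_boot all_order all_algebra.
From mathcomp Require Import all_classical all_reals all_analysis.
Set Implicit Arguments. Unset Strict Implicit. Unset Printing Implicit Defensive.
Import Order.TTheory GRing.Theory Num.Theory.
Import numFieldNormedType.Exports.
Local Open Scope classical_set_scope.
Local Open Scope ring_scope.

Section BF.
Variables (R : realType) (n : nat).

Inductive bnode := BCoin of 'I_n | BConst of R | BLeaf of bool.

(* A (possibly infinite) rooted binary tree: the node reached from the root by
   the outcome sequence s (true = outcome 1) carries label (t s).  The nodes of
   the tree are the sequences all of whose proper prefixes are internal. *)
Definition btree := seq bool -> bnode.

Definition valid_tree (t : btree) : Prop :=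
  forall s c, t s = BConst c -> 0 < c < 1.

Definition is_internal (x : bnode) : bool :=
  match x with BLeaf _ => false | _ => true end.

Definition step_prob (p : 'rV[R]_n) (x : bnode) (b : bool) : R :=
  match x with
  | BCoin i => if b then p ord0 i else 1 - p ord0 i
  | BConst c => if b then c else 1 - c
  | BLeaf _ => 0
  end.

Definition path_prob (t : btree) (p : 'rV[R]_n) (s : seq bool) : R :=
  \prod_(k < size s) step_prob p (t (take k s)) (nth false s k).

Definition leaf_at (t : btree) (s : seq bool) (b : bool) : bool :=
  (match t s with BLeaf b' => b' == b | _ => false end)
  && [forall k : 'I_(size s), is_internal (t (take k s))].

Definition leaf_mass (t : btree) (p : 'rV[R]_n) (b : bool) (L : nat) : R :=
  \sum_(w : L.-tuple bool) (if leaf_at t w b then path_prob t p w else 0).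

Definition terminates_as (t : btree) (p : 'rV[R]_n) : Prop :=
  (fun N => \sum_(L < N) (leaf_mass t p true L + leaf_mass t p false L))
    @ \oo --> (1 : R).

Definition outputs_one_with_prob (t : btree) (p : 'rV[R]_n) (q : R) : Prop :=
  (fun N => \sum_(L < N) leaf_mass t p true L) @ \oo --> q.

Definition cube : set 'rV[R]_n := [set p | forall i, 0 <= p ord0 i <= 1].

Definition implementable (f : 'rV[R]_n -> R) : Prop :=
  exists t : btree, valid_tree t /\
    forall p, cube p -> terminates_as t p /\ outputs_one_with_prob t p (f p).

Definition in_face (A S B : {set 'I_n}) (p : 'rV[R]_n) : Prop :=
  (forall i, i \in A -> p ord0 i = 0) /\
  (forall i, i \in S -> 0 < p ord0 i < 1) /\
  (forall i, i \in B -> p ord0 i = 1).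

Definition is_partition3 (A S B : {set 'I_n}) : Prop :=
  A :&: S = finset.set0 /\ A :&: B = finset.set0 /\ S :&: B = finset.set0 /\
  A :|: S :|: B = finset.setT.

Definition face_monomial (A S B : {set 'I_n}) (p : 'rV[R]_n) : R :=
  (\prod_(i in A) (1 - p ord0 i)) * (\prod_(i in S) (p ord0 i * (1 - p ord0 i)))
  * (\prod_(i in B) p ord0 i).

Definition poly_bounded (f : 'rV[R]_n -> R) : Prop :=
  exists (m : nat) (c : R), 0 < c /\
    forall A S B : {set 'I_n}, is_partition3 A S B ->
      (exists p, in_face A S B p /\ f p <> 0) ->
      forall p, cube p -> c * (face_monomial A S B p) ^+ m <= f p.

End BF.

(* Main.v *)
Require Import Defs.
From HB Require Import structures.
From mathcomp Require Import all_boot all_order all_algebra.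
From mathcomp Require Import all_classical all_reals all_analysis.
From mathcomp Require Import ring lra.
Import Order.TTheory GRing.Theory Num.Theory.
Import numFieldNormedType.Exports.
Set Implicit Arguments. Unset Strict Implicit. Unset Printing Implicit Defensive.
Local Open Scope classical_set_scope.
Local Open Scope ring_scope.

(* Necessity: [f] and [1 - f] are increasing limits of polynomials, so [f] is
   both lower and upper semicontinuous; and a leaf of depth [L] reached with
   positive probability at one point of a face is reached everywhere with
   probability at least a constant times the [L]-th power of the face monomial.

   Sufficiency: it is enough to find a finite factory [g] with [g <= 4 f] and
   [1 - g <= 4 (1 - f)], for then [f = g / 8 + 7 f' / 8] where [f'] satisfies
   the hypotheses again, and iterating writes [f] as a geometric mixture of
   finite factories.  To build [g], guess the face of [p] by rolling one die per
   coin, so that a guess [F] has probability O(mono_F(p) ^ m).  A guess on which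
   [f] is not identically 0 then has probability O(f(p)), one on which [f] is
   not identically 1 has probability O(1 - f(p)), and every guess is of one of
   these kinds.  Guess many times: if all guesses are exclusively of the first
   (second) kind, output 1 (0); otherwise flip a coin [T] which is nearly 0 on
   [f <= 1/4] and nearly 1 on [f >= 3/4].  Such a [T] exists by compactness of
   the cube, and needs no control of its rate of decay near the faces. *)

(** * Output masses of a tree up to a given depth, by recursion at the root *)

Section Mass.
Variables (R : realType) (n : nat).
Implicit Types (t : btree R n) (p : 'rV[R]_n) (b c : bool).

Definition subtree t c : btree R n := fun s => t (c :: s).

Definition partial_mass t p b N := \sum_(L < N) leaf_mass t p b L.

Lemma valid_subtree t c : valid_tree t -> valid_tree (subtree t c).
Proof. by move=> vt s; apply: vt. Qed.

Lemma step_prob_ge0 t p s b :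
  valid_tree t -> cube p -> 0 <= step_prob p (t s) b.
Proof.
move=> vt cp; case E: (t s) => [i|c|//] /=.
  by case: b; have /andP[] := cp i; lra.
by have := vt _ _ E; case: b; lra.
Qed.

Lemma step_prob_total t p s :
  is_internal (t s) -> step_prob p (t s) true + step_prob p (t s) false = 1.
Proof. by case: (t s) => [i|c|//] _ /=; ring. Qed.

Lemma path_prob_cons t p c s :
  path_prob t p (c :: s) =
  step_prob p (t [::]) c * path_prob (subtree t c) p s.
Proof. by rewrite /path_prob /= big_ord_recl. Qed.

Lemma leaf_at_cons t c s b :
  leaf_at t (c :: s) b = is_internal (t [::]) && leaf_at (subtree t c) s b.
Proof.
rewrite /leaf_at {2}/subtree andbCA; congr andb.
apply/forallP/andP => [H|[H0 /forallP H] [[|k] Hk] //].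
  split; first exact: (H ord0).
  by apply/forallP => k; apply: (H (lift ord0 k)).
exact: (H (Ordinal (Hk : (k < size s)%N))).
Qed.

Lemma sum_tupleS L (F : seq bool -> R) :
  \sum_(w : L.+1.-tuple bool) F w = \sum_c \sum_(w : L.-tuple bool) F (c :: w).
Proof.
rewrite pair_big /=.
rewrite (reindex (fun cw : bool * L.-tuple bool => [tuple of cw.1 :: cw.2])) //.
exists (fun w : L.+1.-tuple bool => (thead w, [tuple of behead w])).
  by move=> [c w] _ /=; congr pair; apply: val_inj.
by move=> w _; rewrite -tuple_eta.
Qed.

Lemma leaf_mass0 t p b :
  leaf_mass t p b 0 = (if t [::] is BLeaf b' then b' == b else false)%:R.
Proof.
rewrite /leaf_mass (big_pred1 [tuple]); last by move=> w; apply/esym/eqP; exact: tuple0.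
rewrite /leaf_at /path_prob big_ord0 /= andbC.
have -> : [forall k : 'I_0, is_internal (t (take k [::]))].
  by apply/forallP => -[].
by case: (t [::]) => [i|x|l] //=; case: (l == b).
Qed.

(** No case distinction is needed: if the root is a leaf, nothing lies below it on the left, and
    [step_prob] is 0 on the right. *)
Lemma leaf_massS t p b L :
  leaf_mass t p b L.+1 =
  \sum_c step_prob p (t [::]) c * leaf_mass (subtree t c) p b L.
Proof.
rewrite /leaf_mass
  (sum_tupleS _ (fun w => if leaf_at t w b then path_prob t p w else 0)).
apply: eq_bigr => c _; rewrite mulr_sumr; apply: eq_bigr => w _.
rewrite leaf_at_cons path_prob_cons.
by case: (t [::]) => [i|x|l] /=; case: ifP; rewrite ?mulr0 ?mul0r.
Qed.

Lemma partial_mass0 t p b : partial_mass t p b 0 = 0.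
Proof. exact: big_ord0. Qed.

Lemma partial_massS t p b N :
  partial_mass t p b N.+1 = leaf_mass t p b 0 +
  \sum_c step_prob p (t [::]) c * partial_mass (subtree t c) p b N.
Proof.
rewrite /partial_mass big_ord_recl; congr (_ + _).
under eq_bigr do rewrite leaf_massS.
by rewrite exchange_big; apply: eq_bigr => c _; rewrite mulr_sumr.
Qed.

Lemma leaf_mass_ge0 t p b L : valid_tree t -> cube p -> 0 <= leaf_mass t p b L.
Proof.
move=> vt cp; elim: L t vt => [|L IH] t vt; first by rewrite leaf_mass0.
rewrite leaf_massS; apply: sumr_ge0 => c _; apply: mulr_ge0.
  exact: step_prob_ge0.
exact/IH/valid_subtree.
Qed.

Lemma partial_mass_total t p N : valid_tree t -> cube p ->
  partial_mass t p true N + partial_mass t p false N <= 1.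
Proof.
move=> vt cp; elim: N t vt => [|N IH] t vt; first by rewrite !partial_mass0 addr0.
rewrite !partial_massS !leaf_mass0 !big_bool /=.
have := IH _ (valid_subtree (c := true) vt); have := IH _ (valid_subtree (c := false) vt).
have := step_prob_ge0 [::] true vt cp; have := step_prob_ge0 [::] false vt cp.
have := @step_prob_total t p [::].
case: (t [::]) => [i|x|l] /=; last by case: l => /=; lra.
  by move=> _ ? ? ? ?; nra.
by move=> _ ? ? ? ?; nra.
Qed.

Lemma partial_mass_ge0 t p b N :
  valid_tree t -> cube p -> 0 <= partial_mass t p b N.
Proof. by move=> vt cp; apply: sumr_ge0 => L _; apply: leaf_mass_ge0. Qed.

Lemma partial_mass_le1 t p b N :
  valid_tree t -> cube p -> partial_mass t p b N <= 1.
Proof.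
move=> vt cp; have := partial_mass_total N vt cp.
have := partial_mass_ge0 true N vt cp; have := partial_mass_ge0 false N vt cp.
by case: b; lra.
Qed.

(* Equivalent, by [simulatesP], to almost sure termination with output
   probability [q], but symmetric in the outputs 0 and 1. *)
Definition simulates t p (q : R) :=
  forall b, partial_mass t p b @ \oo --> (if b then q else 1 - q : R).

Lemma simulatesP t p q :
  simulates t p q <-> terminates_as t p /\ outputs_one_with_prob t p q.
Proof.
have E N : \sum_(L < N) (leaf_mass t p true L + leaf_mass t p false L) =
    partial_mass t p true N + partial_mass t p false N by rewrite big_split.
rewrite /terminates_as; under eq_fun do rewrite E.
split=> [H|[H1 H2] [//|]].
  split; last exact: (H true).
  have -> : (1 : R) = q + (1 - q) by ring.
  exact: (cvgD (H true) (H false)).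
have -> : partial_mass t p false =
    (fun N => partial_mass t p true N + partial_mass t p false N
              - partial_mass t p true N).
  by apply/funext => N; ring.
exact: cvgB.
Qed.

(** Truncation gives lower bounds for both [q] and [1 - q]; continuity and polynomial boundedness
    are both read off from them. *)
Lemma partial_mass_le_lim t p q b N :
  valid_tree t -> cube p -> simulates t p q ->
  partial_mass t p b N <= (if b then q else 1 - q).
Proof.
move=> vt cp /(_ b) H; rewrite -(cvg_lim _ H)//.
apply: nondecreasing_cvgn_le; last by apply/cvg_ex; eexists; exact: H.
apply/nondecreasing_seqP => k; rewrite /partial_mass big_ord_recr /=.
by rewrite lerDl leaf_mass_ge0.
Qed.

End Mass.

(** * Convergence of geometric mixtures *)

Section Mixture.
Variable R : realType.

(** Unrolling the recursion [j] times leaves a tail of weight [(1 - a) ^+ j], whose error is at most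
    1, and finitely many errors of the components, which tend to 0. *)
Lemma mixture_cvg (a : R) (s S : nat -> nat -> R) (G F : nat -> R) :
  0 < a < 1 ->
  (forall k N, S k N.+1 = a * s k N + (1 - a) * S k.+1 N) ->
  (forall k, s k @ \oo --> G k) ->
  (forall k, F k = a * G k + (1 - a) * F k.+1) ->
  (forall k N, `|F k - S k N| <= 1) ->
  forall k, S k @ \oo --> F k.
Proof.
move=> /andP[a0 a1] SE sG FE F1.
(* All [k] are treated at once because the recursion moves to [k.+1]. The error [e] does not grow,
   since the weights [a] and [1 - a] sum to 1. *)
have approx j : forall e k, 0 < e -> exists N0, forall N, (N0 <= N)%N ->
    `|F k - S k N| <= (1 - a) ^+ j + e.
  elim: j => [|j IH] e k e0.
    by exists 0%N => N _; rewrite expr0; apply: le_trans (F1 k N) _; lra.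
  have /cvgrPdist_le/(_ _ e0)[N1 _ H1] := sG k.
  have [N2 H2] := IH e k.+1 e0.
  exists (maxn N1 N2).+1 => -[//|N]; rewrite ltnS geq_max => /andP[h1 h2].
  have -> : F k - S k N.+1 = a * (G k - s k N) + (1 - a) * (F k.+1 - S k.+1 N).
    by rewrite FE SE; ring.
  have a10 : 0 <= 1 - a by lra.
  apply: le_trans (ler_normD _ _) _.
  rewrite !normrM (gtr0_norm a0) (ger0_norm a10) exprS.
  have := ler_wpM2l (ltW a0) (H1 N h1); have := ler_wpM2l a10 (H2 N h2).
  by move=> /=; lra.
move=> k; apply/cvgrPdist_le => e e0.
have a10 : `|1 - a| < 1 by rewrite ger0_norm; lra.
have e20 : 0 < e / 2 by lra.
have /cvgrPdist_le/(_ _ e20)[j _ /(_ j (leqnn j))/=] := cvg_expr a10.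
rewrite sub0r normrN => /(le_trans (ler_norm _)) Hj.
have [N0 HN] := approx j _ k e20.
by exists N0 => // N /HN /= /le_trans; apply; lra.
Qed.

End Mixture.

(** * Constructions of trees, and the finite factories [sim] *)

Section Trees.
Variables (R : realType) (n : nat).
Implicit Types (t l r : btree R n) (f g h : 'rV[R]_n -> R).

Definition realizes t f :=
  valid_tree t /\ forall p, cube p -> simulates t p (f p).

Lemma implementableP f : implementable f <-> exists t, realizes t f.
Proof.
by split=> -[t [vt H]]; exists t; split=> // p /H; rewrite simulatesP.
Qed.

Definition leaf_tree b : btree R n := fun=> @BLeaf R n b.

Definition node_tree x l r : btree R n :=
  fun s => if s is c :: s' then if c then l s' else r s' else x.

Lemma realizes_leaf b : realizes (leaf_tree b) (fun=> b%:R).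
Proof.
(* Even the root is counted only from index 1 on, hence the shift. *)
split=> // p _ b'; rewrite -cvg_shiftS /=.
under eq_fun do
  rewrite partial_massS leaf_mass0 big_bool /= !mul0r !addr0.
have -> : (b == b')%:R = (if b' then b%:R else 1 - b%:R) :> R.
  by case: b b' => -[] /=; ring.
exact: cvg_cst.
Qed.

Lemma realizes_node x l r g h :
  is_internal x -> (forall c, x = BConst n c -> 0 < c < 1) ->
  realizes l g -> realizes r h ->
  realizes (node_tree x l r)
    (fun p => step_prob p x true * g p + step_prob p x false * h p).
Proof.
move=> ix cx [vl Hl] [vr Hr]; split.
  by move=> [|[] s] c /=; [exact: cx|exact: vl|exact: vr].
move=> p cp b; rewrite -cvg_shiftS /=.
have -> : (fun N => partial_mass (node_tree x l r) p b N.+1) =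
    (fun N => step_prob p x true * partial_mass l p b N
            + step_prob p x false * partial_mass r p b N).
  apply/funext => N; rewrite partial_massS leaf_mass0 big_bool /=.
  by case: x ix {cx} => //= *; rewrite add0r.
have -> : (if b then step_prob p x true * g p + step_prob p x false * h p
      else 1 - (step_prob p x true * g p + step_prob p x false * h p)) =
    step_prob p x true * (if b then g p else 1 - g p) +
    step_prob p x false * (if b then h p else 1 - h p).
  case: b => //; have := @step_prob_total R n (fun=> x) p [::] ix.
  by move=> /(canRL (addrK _)) ->; ring.
by apply: cvgD; apply: cvgM; [exact: cvg_cst|exact: Hl|exact: cvg_cst|exact: Hr].
Qed.

(** An infinite path of constant nodes [a]; outcome 1 at the [j]-th of them enters [tk (k + j)],
    outcome 0 moves on along the path. *)
Fixpoint spine (a : R) (tk : nat -> btree R n) (k : nat) (s : seq bool) :=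
  match s with
  | [::] => BConst n a
  | true :: s' => tk k s'
  | false :: s' => spine a tk k.+1 s'
  end.

(** [f k] is what the spine computes from its [k]-th node on. Bounded tails and the one-step
    recursion take the place of an infinite series. *)
Lemma implementable_mixture (a : R) (f g : nat -> 'rV[R]_n -> R) :
  0 < a < 1 -> (forall k p, cube p -> 0 <= f k p <= 1) ->
  (forall k, implementable (g k)) ->
  (forall k p, cube p -> f k p = a * g k p + (1 - a) * f k.+1 p) ->
  implementable (f 0%N).
Proof.
move=> a01 f01 ig fE.
have [tk Htk] := choice (fun k => (implementableP (g k)).1 (ig k)).
have vs k : valid_tree (spine a tk k).
  move=> s; elim: s k => [|[] s IH] k c /=; first by case=> <-.
    by have [] := Htk k => v _ /v.
  exact: IH.
apply/implementableP; exists (spine a tk 0); split => // p cp b.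
apply: (@mixture_cvg _ a (fun k => partial_mass (tk k) p b)
  (fun k => partial_mass (spine a tk k) p b)
  (fun k => if b then g k p else 1 - g k p)
  (fun k => if b then f k p else 1 - f k p)) => //.
- by move=> k N; rewrite partial_massS leaf_mass0 big_bool /= add0r.
- by move=> k; have [_ /(_ p cp)] := Htk k.
- by move=> k; rewrite fE//; case: b; ring.
- move=> k N; have := f01 k _ cp.
  have := partial_mass_ge0 b N (vs k) cp; have := partial_mass_le1 b N (vs k) cp.
  by rewrite ler_norml; case: b; lra.
Qed.

(* The output probabilities of finite trees without constant nodes. *)
Inductive sim : ('rV[R]_n -> R) -> Prop :=
| sim_out (b : bool) : sim (fun=> b%:R)
| sim_coin i g h : sim g -> sim h ->
    sim (fun p => p ord0 i * g p + (1 - p ord0 i) * h p).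

Lemma sim_implementable g : sim g -> implementable g.
Proof.
elim=> {g} [b|i g h _ ig _ ih].
  by apply/implementableP; exists (leaf_tree b); apply: realizes_leaf.
have [[l Hl] [r Hr]] := ((implementableP _).1 ig, (implementableP _).1 ih).
apply/implementableP; exists (node_tree (BCoin R i) l r).
exact: (@realizes_node (BCoin R i)).
Qed.

Lemma sim_range g p : sim g -> cube p -> 0 <= g p <= 1.
Proof.
move=> sg cp; elim: sg => {g} [b|i g h _ IHg _ IHh].
  by case: b; rewrite /=; lra.
by have /andP[] := cp i; nra.
Qed.

Lemma sim_cvg g (p : 'rV[R]_n) : sim g -> g @ nbhs p --> g p.
Proof.
move=> sg; elim: sg => {g} [b|i g h _ cg _ ch]; first exact: cvg_cst.
have cX : (fun q : 'rV[R]_n => q ord0 i) @ nbhs p --> p ord0 i.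
  exact: coord_continuous.
have cX' : (fun q : 'rV[R]_n => 1 - q ord0 i) @ nbhs p --> 1 - p ord0 i.
  by apply: cvgB => //; exact: cvg_cst.
exact: (cvgD (cvgM cX cg) (cvgM cX' ch)).
Qed.

(** Graft [g] on the leaves 1 and [h] on the leaves 0 of the tree of [x]. Complements, products and
    powers are special cases. *)
Lemma sim_ite x g h : sim x -> sim g -> sim h ->
  sim (fun p => x p * g p + (1 - x p) * h p).
Proof.
move=> sx sg sh; elim: sx => {x} [b|i x y _ IHx _ IHy].
  suff -> : (fun p => b%:R * g p + (1 - b%:R) * h p) = if b then g else h.
    by case: b.
  by apply/funext => p; case: b => /=; ring.
have := sim_coin i IHx IHy; congr sim.
by apply/funext => p; ring.
Qed.

Lemma sim_proj i : sim (fun p => p ord0 i).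
Proof.
have := sim_coin i (sim_out true) (sim_out false); congr sim.
by apply/funext => p /=; ring.
Qed.

Lemma sim_onem g : sim g -> sim (fun p => 1 - g p).
Proof.
move=> sg; have := sim_ite sg (sim_out false) (sim_out true); congr sim.
by apply/funext => p /=; ring.
Qed.

Lemma sim_mul g h : sim g -> sim h -> sim (fun p => g p * h p).
Proof.
move=> sg sh; have := sim_ite sg sh (sim_out false); congr sim.
by apply/funext => p /=; ring.
Qed.

Lemma sim_exp g k : sim g -> sim (fun p => g p ^+ k).
Proof.
move=> sg; elim: k => [|k IH]; first exact: (sim_out true).
have := sim_mul sg IH; congr sim.
by apply/funext => p; rewrite exprS.
Qed.

End Trees.

(** * Faces as maps, and polynomial bounds in terms of them *)

Section Faces.
Variables (R : realType) (n : nat).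
Implicit Types (f g h : 'rV[R]_n -> R) (p q : 'rV[R]_n)
  (tau : 'I_n -> option bool).

(* A face F_(A,S,B) is encoded by a map [tau] sending A to [Some false],
   B to [Some true] and S to [None]. *)
Definition mu (o : option bool) (x : R) : R :=
  match o with Some false => 1 - x | Some true => x | None => x * (1 - x) end.

Definition cell (o : option bool) (x : R) : Prop :=
  match o with Some false => x = 0 | Some true => x = 1 | None => 0 < x < 1 end.

Definition on_face tau p := forall i, cell (tau i) (p ord0 i).

Definition mono tau p : R := \prod_i mu (tau i) (p ord0 i).

Definition face_bounded (m : nat) (c : R) f :=
  forall tau, (exists p, on_face tau p /\ f p <> 0) ->
    forall p, cube p -> c * mono tau p ^+ m <= f p.

Lemma in_faceE tau p :
  in_face [set i | tau i == Some false] [set i | tau i == None]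
    [set i | tau i == Some true] p <-> on_face tau p.
Proof.
split=> [[HA [HS HB]] i|H].
  case E: (tau i) => [[]|] /=.
  - by apply: HB; rewrite inE E.
  - by apply: HA; rewrite inE E.
  - by apply: HS; rewrite inE E.
by do !split; move=> i; rewrite inE => /eqP E; have := H i; rewrite E.
Qed.

Lemma face_monomialE tau p :
  face_monomial [set i | tau i == Some false] [set i | tau i == None]
    [set i | tau i == Some true] p = mono tau p.
Proof.
rewrite /face_monomial /mono.
rewrite [X in X * _ * _]big_mkcond [X in _ * X * _]big_mkcond.
rewrite [X in _ * _ * X]big_mkcond -!big_split; apply: eq_bigr => i _ /=.
by rewrite !inE; case: (tau i) => [[]|] /=; rewrite ?mulr1 ?mul1r.
Qed.

Lemma partition3P (A S B : {set 'I_n}) : is_partition3 A S B <->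
  exists tau, [/\ A = [set i | tau i == Some false]%SET,
                  S = [set i | tau i == None]%SET &
                  B = [set i | tau i == Some true]%SET].
Proof.
split=> [[AS [AB [SB ASB]]]|[tau [-> -> ->]]].
  exists (fun i => if i \in A then Some false
                   else if i \in S then None else Some true).
  split; apply/setP => i; have := finset.in_setT i; rewrite -ASB !inE;
    move/setP/(_ i): AS; move/setP/(_ i): AB; move/setP/(_ i): SB;
    by rewrite !inE; case: (i \in A); case: (i \in S); case: (i \in B).
by do !split; apply/setP => i; rewrite !inE; case: (tau i) => [[]|].
Qed.

Lemma poly_boundedP f :
  poly_bounded f <-> exists m c, 0 < c /\ face_bounded m c f.
Proof.
split=> -[m [c [c0 H]]]; exists m, c; split => //.
  move=> tau [p0 [/in_faceE p0t fp0]] p cp; rewrite -face_monomialE.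
  apply: H => //; last by exists p0.
  by apply/partition3P; exists tau.
move=> A S B /partition3P[tau [-> -> ->]] [p0 [/in_faceE p0t fp0]] p cp.
by rewrite face_monomialE; apply: H => //; exists p0.
Qed.

Lemma mu_range o x : 0 <= x <= 1 -> 0 <= mu o x <= 1.
Proof. by move=> /andP[? ?]; case: o => [[]|] /=; nra. Qed.

Lemma mono_range tau p : cube p -> 0 <= mono tau p <= 1.
Proof.
move=> cp; rewrite prodr_ge0 ?prodr_ile1// => i; first by move=> _; exact: mu_range.
by move=> _; have /andP[] := mu_range (tau i) (cp i).
Qed.

Lemma mono_le_mu tau p i : cube p -> mono tau p <= mu (tau i) (p ord0 i).
Proof.
move=> cp; rewrite /mono (bigD1 i) //= ler_piMr//.
  by have /andP[] := mu_range (tau i) (cp i).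
by apply: prodr_ile1 => j _; exact: mu_range.
Qed.

Lemma on_face_cube tau p : on_face tau p -> cube p.
Proof. by move=> H i; have := H i; case: (tau i) => [[]|] /=; lra. Qed.

Lemma face_boundedW m m' c c' f : (m <= m')%N -> 0 < c' <= c ->
  face_bounded m c f -> face_bounded m' c' f.
Proof.
move=> mm' /andP[c0 cc'] H tau E p cp; apply: le_trans (H tau E p cp).
have /andP[M0 M1] := mono_range tau cp.
apply: ler_pM => //; [exact: ltW|exact: exprn_ge0|].
exact: ler_wiXn2l.
Qed.

(** The property survives enlarging [m] and shrinking [c], so a maximum and a minimum over the
    finite type suffice. *)
Lemma finite_uniform (T : finType) (P : T -> nat -> R -> Prop) :
  (forall x m m' c c', (m <= m')%N -> 0 < c' <= c -> P x m c -> P x m' c') ->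
  (forall x, exists m c, 0 < c /\ P x m c) ->
  exists m c, 0 < c /\ forall x, P x m c.
Proof.
move=> PW HP.
suff [m [c [c0 H]]] : exists m c, 0 < c /\ forall x, x \in enum T -> P x m c.
  by exists m, c; split=> // x; apply: H; rewrite mem_enum.
elim: (enum T) => [|x s [m [c [c0 IH]]]]; first by exists 0%N, 1.
have [m' [c' [c'0 Hx]]] := HP x.
exists (maxn m m'), (Num.min c c'); rewrite lt_min c0 c'0; split=> // y.
rewrite inE => /orP[/eqP->|ys].
  by apply: PW Hx; rewrite ?leq_maxr// lt_min c0 c'0 ge_min lexx orbT.
by apply: (PW _ _ _ _ _ _ _ (IH y ys));
  rewrite ?leq_maxl// lt_min c0 c'0 ge_min lexx.
Qed.

Lemma within_cubeP f : {within cube (R:=R) (n:=n), continuous f} <->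
  forall p, cube p -> forall e, 0 < e ->
    \forall q \near nbhs p, cube q -> `|f p - f q| < e.
Proof.
rewrite subspace_continuousP; split => H p cp.
  by move=> e e0; have /cvgrPdist_lt := H p cp; exact.
by apply/cvgrPdist_lt => e e0; exact: H.
Qed.

End Faces.

(** * Necessity: continuity and polynomial bounds *)

Section Necessity.
Variables (R : realType) (n : nat).
Implicit Types (t : btree R n) (p : 'rV[R]_n) (tau : 'I_n -> option bool).

Lemma step_prob_cvg x c p :
  (fun q : 'rV[R]_n => step_prob q x c) @ nbhs p --> step_prob p x c.
Proof.
have cX i : (fun q : 'rV[R]_n => q ord0 i) @ nbhs p --> p ord0 i.
  exact: coord_continuous.
case: x => [i|a|b] /=; try exact: cvg_cst.
by case: c => //; apply: cvgB => //; exact: cvg_cst.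
Qed.

Lemma partial_mass_cvg t b N p :
  (fun q => partial_mass t q b N) @ nbhs p --> partial_mass t p b N.
Proof.
elim: N t => [|N IH] t.
  rewrite partial_mass0; under eq_fun do rewrite partial_mass0.
  exact: cvg_cst.
rewrite partial_massS leaf_mass0 big_bool /=.
under eq_fun do rewrite partial_massS leaf_mass0 big_bool /=.
apply: cvgD; first exact: cvg_cst.
by apply: cvgD; apply: cvgM; [exact: step_prob_cvg|exact: IH
  |exact: step_prob_cvg|exact: IH].
Qed.

(** Truncations that are [e / 2]-accurate at [p] move by less than [e / 2] near [p]. Being lower
    bounds for [f q] and [1 - f q], they confine [f q] from both sides. *)
Lemma realizes_continuous t (f : 'rV[R]_n -> R) :
  realizes t f -> {within cube (R:=R) (n:=n), continuous f}.
Proof.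
move=> [vt H]; apply/within_cubeP => p cp e e0.
have e20 : 0 < e / 2 by lra.
have /cvgrPdist_lt/(_ _ e20)[N1 _ HN1] := H p cp true.
have /cvgrPdist_lt/(_ _ e20)[N2 _ HN2] := H p cp false.
have /cvgrPdist_lt/(_ _ e20) D1 := @partial_mass_cvg t true N1 p.
have /cvgrPdist_lt/(_ _ e20) D2 := @partial_mass_cvg t false N2 p.
apply: filterS2 D1 D2 => q D1 D2 cq.
have := HN1 N1 (leqnn _); have := HN2 N2 (leqnn _) => /=.
have := partial_mass_le_lim true N1 vt cq (H q cq).
have := partial_mass_le_lim false N2 vt cq (H q cq).
move: D1 D2; rewrite !ltr_norml; lra.
Qed.

(** If an outcome of coin [i] is possible on the face, its probability is a factor of [mu (tau i)],
    whose other factor is at most 1. At a constant node, [mono] is at most 1. *)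
Lemma step_prob_lower x c tau p0 : (forall d, x = BConst n d -> 0 < d < 1) ->
  on_face tau p0 -> 0 < step_prob p0 x c ->
  exists d, 0 < d /\ forall p, cube p -> d * mono tau p <= step_prob p x c.
Proof.
move=> vx p0t; case: x vx => [i|d|b] vx /= s0; last by rewrite ltxx in s0.
  exists 1; split=> // p cp; rewrite mul1r.
  apply: le_trans (mono_le_mu tau i cp) _.
  have := p0t i; have := cp i.
  by case: (tau i) c s0 => [[]|] [] /=; nra.
exists (if c then d else 1 - d); split=> // p cp.
by have := mono_range tau cp; case: c s0; nra.
Qed.

(** Follow one path that has positive probability at [p0]: each of its [L] steps costs one factor
    [mono tau p]. *)
Lemma leaf_mass_lower t tau p0 b L : valid_tree t -> on_face tau p0 ->
  0 < leaf_mass t p0 b L ->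
  exists c, 0 < c /\
    forall p, cube p -> c * mono tau p ^+ L <= leaf_mass t p b L.
Proof.
move=> vt p0t; have cp0 := on_face_cube p0t.
elim: L t vt => [|L IH] t vt.
  rewrite leaf_mass0 => H; exists 1; split=> // p cp; rewrite leaf_mass0 mulr1.
  by move: H; case: (t [::]) => [?|?|l]; rewrite ?ltxx//; case: (l == b) => //=;
    rewrite ltxx.
rewrite leaf_massS.
have H0 c : 0 <= step_prob p0 (t [::]) c * leaf_mass (subtree t c) p0 b L.
  by rewrite mulr_ge0 ?step_prob_ge0 ?leaf_mass_ge0//; exact: valid_subtree.
have nonneg c p : cube p ->
    0 <= step_prob p (t [::]) c * leaf_mass (subtree t c) p b L.
  by move=> ?; rewrite mulr_ge0 ?step_prob_ge0 ?leaf_mass_ge0//; exact: valid_subtree.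
move=> Hpos; have [c Hc] : exists c, 0 < step_prob p0 (t [::]) c *
    leaf_mass (subtree t c) p0 b L.
  move: Hpos; rewrite big_bool /= => Hpos.
  have := H0 true; rewrite le_eqVlt => /orP[/eqP E|]; last by exists true.
  by exists false; rewrite -E add0r in Hpos.
have vc : valid_tree (subtree t c) by exact: valid_subtree.
have s0 := step_prob_ge0 [::] c vt cp0.
have l0 := leaf_mass_ge0 b L vc cp0.
have s1 : 0 < step_prob p0 (t [::]) c.
  by rewrite lt_neqAle s0 andbT; apply: contraTneq Hc => <-; rewrite mul0r ltxx.
have l1 : 0 < leaf_mass (subtree t c) p0 b L.
  by rewrite lt_neqAle l0 andbT; apply: contraTneq Hc => <-; rewrite mulr0 ltxx.
have [d [d0 Hd]] := step_prob_lower (vt [::]) p0t s1.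
have [e [e0 He]] := IH _ vc l1.
exists (d * e); split=> [|p cp]; first exact: mulr_gt0.
have /andP[M0 _] := mono_range tau cp.
rewrite leaf_massS (bigD1 c)//=; apply: ler_wpDr.
  by apply: sumr_ge0 => c' _; exact: nonneg.
rewrite exprS mulrACA; apply: ler_pM; [| |exact: Hd|exact: He].
  by rewrite mulr_ge0// ltW.
by rewrite mulr_ge0 ?exprn_ge0// ltW.
Qed.

Lemma simulates_positive_leaf t p (q : R) b : valid_tree t -> cube p ->
  simulates t p q -> (if b then q else 1 - q) <> 0 ->
  exists L, 0 < leaf_mass t p b L.
Proof.
move=> vt cp H q0; apply: contrapT => /forallNP L0; apply: q0.
have {}L0 L : leaf_mass t p b L = 0.
  apply/eqP; rewrite eq_le leaf_mass_ge0// andbT leNgt.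
  exact/negP/L0.
apply: (cvg_unique _ (H b)) => //.
have -> : partial_mass t p b = fun=> 0.
  by apply/funext => N; apply: big1.
exact: cvg_cst.
Qed.

Lemma realizes_poly_bounded t (f : 'rV[R]_n -> R) b :
  realizes t f -> poly_bounded (fun p => if b then f p else 1 - f p).
Proof.
move=> [vt H]; apply/poly_boundedP.
set fb := fun p => _.
(* There are finitely many faces, so one exponent and one constant serve all; [ffun] provides the
   [finType]. *)
have [||m [c [c0 Hmc]]] := @finite_uniform R {ffun 'I_n -> option bool}
  (fun (tau : {ffun 'I_n -> option bool}) m c => (exists p, on_face tau p /\ fb p <> 0) ->
    forall p, cube p -> c * mono tau p ^+ m <= fb p).
- move=> tau m m' c c' mm' /andP[c0 cc'] Hm E p cp; apply: le_trans (Hm E p cp).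
  have /andP[M0 M1] := mono_range tau cp.
  by apply: ler_pM; rewrite ?exprn_ge0 ?ler_wiXn2l// ltW.
- move=> tau; have [[p0 [p0t f0]]|nE] :=
    pselect (exists p, on_face tau p /\ fb p <> 0); last by exists 0%N, 1.
  have cp0 := on_face_cube p0t.
  have [L HL] := simulates_positive_leaf vt cp0 (H p0 cp0) f0.
  have [c [c0 Hc]] := leaf_mass_lower vt p0t HL.
  exists L, c; split=> // _ p cp; apply: le_trans (Hc p cp) _.
  apply: le_trans (partial_mass_le_lim b L.+1 vt cp (H p cp)).
  by rewrite /partial_mass big_ord_recr /= lerDr partial_mass_ge0.
exists m, c; split=> // tau.
have -> : tau = [ffun i => tau i] by apply/funext => i; rewrite ffunE.
exact: (Hmc [ffun i => tau i]).
Qed.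

End Necessity.

(** * Compactness of the cube *)

Lemma compact_local_to_global (X : topologicalType) (K : set X)
    (Q : set X -> Prop) :
  compact K -> Q set0 -> (forall U V, Q U -> Q V -> Q (U `|` V)) ->
  (forall x, K x -> exists2 U, nbhs x U & Q U) ->
  exists2 U, K `<=` U & Q U.
Proof.
move=> cK Q0 QU locQ; apply: contrapT => noQ.
(* The sets containing [K] minus a good set form a filter, proper if no good set covers [K]. A
   cluster point of it would have no good neighbourhood. *)
pose F : set_system X := [set W | exists2 U, Q U & K `\` U `<=` W].
have FF : ProperFilter F.
  split.
    move=> [U QU' KU]; apply: noQ; exists U => // x Kx.
    by apply: contrapT => Ux; exact: (KU x).
  split.
  - by exists set0.
  - move=> A B [U QU1 KUA] [V QV KVB]; exists (U `|` V); first exact: QU.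
    by move=> x [Kx /not_orP[Ux Vx]]; split; [apply: KUA|apply: KVB].
  - by move=> A B AB [U QU1 KUA]; exists U => //; exact: subset_trans AB.
have [|x [Kx clx]] := cK F FF; first by exists set0 => // x [].
have [U Ux QU1] := locQ x Kx.
have [|y [[_ nUy] Uy]] := clx (K `\` U) U _ Ux; last by [].
by exists U.
Qed.

Lemma compact_cube (R : realType) (n : nat) : compact (@cube R n).
Proof.
have -> : @cube R n = [set p | forall i, `[0, 1]%classic (p ord0 i)].
  by apply/seteqP; split=> p H i; have := H i; rewrite /= in_itv.
by apply: (@rV_compact R n (fun=> `[0, 1]%classic)) => _; exact: segment_compact.
Qed.

(** * Bernoulli inequalities and sharp thresholds *)

Section Amplification.
Variable R : realType.
Implicit Types u x y : R.

Lemma bernoulli_le u k : 0 <= u <= 1 -> 1 - k%:R * u <= (1 - u) ^+ k.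
Proof.
move=> /andP[u0 u1]; elim: k => [|k IH]; first by rewrite mul0r subr0.
have : 0 <= (k%:R : R) by [].
rewrite exprS -natr1 => k0.
apply: (@le_trans _ _ ((1 - u) * (1 - k%:R * u))).
  have : 0 <= k%:R * (u * u) by rewrite !mulr_ge0.
  lra.
by apply: ler_wpM2l => //; lra.
Qed.

Lemma bernoulli_ge u k : 0 <= u <= 1 -> (1 - u) ^+ k * (1 + k%:R * u) <= 1.
Proof.
move=> /andP[u0 u1]; elim: k => [|k IH]; first by rewrite mul0r addr0 mulr1.
have k0 : 0 <= (k%:R : R) by [].
have P0 : 0 <= (1 - u) ^+ k by rewrite exprn_ge0// subr_ge0.
apply: le_trans IH; rewrite exprS -mulrA mulrCA; apply: ler_wpM2l => //.
rewrite -natr1.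
have : 0 <= k%:R * (u * u) by rewrite !mulr_ge0.
nra.
Qed.

Lemma expr_small (x e : R) : 0 <= x < 1 -> 0 < e -> exists k, x ^+ k <= e.
Proof.
move=> /andP[x0 x1] e0; have nx : `|x| < 1 by rewrite ger0_norm.
have /cvgrPdist_le/(_ _ e0)[k _ /(_ k (leqnn k))/=] := cvg_expr nx.
by rewrite sub0r normrN => /(le_trans (ler_norm _)); exists k.
Qed.

(* The curve x |-> 1 - (1 - x^N)^M jumps from near 0 to near 1 around
   x = M^(-1/N). *)
Lemma threshold_exponents (s r e : R) : 0 < s -> s < r -> r < 1 -> 0 < e ->
  exists N M, forall x, 0 <= x <= 1 ->
    (x <= s -> 1 - (1 - x ^+ N) ^+ M <= e) /\
    (r <= x -> 1 - e <= 1 - (1 - x ^+ N) ^+ M).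
Proof.
move=> s0 sr r1 e0; have r0 : 0 < r by lra.
have [N1 HN1] : exists k, (s / r) ^+ k <= e * e / 2.
  apply: expr_small; last by rewrite divr_gt0// mulr_gt0.
  by rewrite divr_ge0 ?ltr_pdivrMr ?mul1r// ltW.
have [N2 HN2] : exists k, s ^+ k <= e / 2.
  by apply: expr_small; [apply/andP; split; lra|lra].
pose N := (N1 + N2)%N.
have sN : s ^+ N <= e / 2.
  apply: le_trans HN2; apply: ler_wiXn2l; rewrite ?leq_addl//; lra.
have srN : (s / r) ^+ N <= e * e / 2.
  apply: le_trans HN1; apply: ler_wiXn2l; rewrite ?leq_addr//.
    by rewrite divr_ge0// ltW.
  by rewrite ler_pdivrMr// mul1r ltW.
have rN : 0 < r ^+ N by rewrite exprn_gt0.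
(* [M] is [z] rounded up. From [z <= M] follows [M * r ^+ N >= 1 / e], and from [M <= z + 1] follows
   [M * s ^+ N <= (s / r) ^+ N / e + s ^+ N <= e]. *)
pose z := (e * r ^+ N)^-1.
have z0 : 0 <= z by rewrite invr_ge0 mulr_ge0// ltW.
pose M := (Num.trunc z).+1.
have zM : z <= M%:R by apply: ltW; exact: truncnS_gt.
have Mz : M%:R <= z + 1 by rewrite /M -natr1 lerD2r truncn_le.
exists N, M => x /andP[x0 x1].
have xN : 0 <= x ^+ N <= 1 by rewrite exprn_ge0// exprn_ile1.
split=> [xs|rx].
  have := bernoulli_le M xN.
  have : M%:R * x ^+ N <= (z + 1) * s ^+ N.
    by apply: ler_pM; rewrite ?exprn_ge0// lerXn2r// nnegrE// ltW.
  have : z * s ^+ N <= e / 2.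
    have -> : z * s ^+ N = (s / r) ^+ N / e.
      by rewrite /z expr_div_n invfM; ring.
    by rewrite ler_pdivrMr// mulrAC.
  lra.
have := bernoulli_ge M xN.
have : e^-1 <= M%:R * x ^+ N.
  have -> : e^-1 = z * r ^+ N by rewrite /z invfM mulfVK ?gt_eqF.
  by apply: ler_pM => //; [exact: ltW|rewrite lerXn2r// nnegrE// ltW].
have P0 : 0 <= (1 - x ^+ N) ^+ M.
  by rewrite exprn_ge0// subr_ge0; have /andP[] := xN.
move=> He HP; suff : (1 - x ^+ N) ^+ M / e <= 1.
  by rewrite ler_pdivrMr// mul1r; lra.
have := ler_wpM2l P0 He; lra.
Qed.

End Amplification.

(** * Separating sublevel and superlevel sets by finite factories *)

Section Separation.
Variables (R : realType) (n : nat).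
Implicit Types (f g h T : 'rV[R]_n -> R) (p x y : 'rV[R]_n) (e : R).

Lemma sim_threshold g s r e : sim g -> 0 < s -> s < r -> r < 1 -> 0 < e ->
  exists2 T, sim T & forall p, cube p ->
    (g p <= s -> T p <= e) /\ (r <= g p -> 1 - e <= T p).
Proof.
move=> sg s0 sr r1 e0; have [N [M H]] := threshold_exponents s0 sr r1 e0.
exists (fun p => 1 - (1 - g p ^+ N) ^+ M).
  exact/sim_onem/sim_exp/sim_onem/sim_exp.
by move=> p cp; apply: H; exact: sim_range.
Qed.

(** Some coordinate or its complement is smaller at [x] than at [y]; apply a threshold to it. The
    neighbourhoods are chosen before [e], as the compactness arguments require. *)
Lemma sim_separate_points x y : cube x -> cube y -> x <> y ->
  exists U V, [/\ nbhs x U, nbhs y V & forall e, 0 < e -> exists2 T, sim T &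
    forall p, cube p -> (U p -> T p <= e) /\ (V p -> 1 - e <= T p)].
Proof.
move=> cx cy xy.
have [g sg gxy] : exists2 g, sim g & g x < g y.
  have [i /eqP xyi] : exists i, x ord0 i <> y ord0 i.
    by apply/existsNP => H; apply: xy; apply/rowP => i.
  have [lt_xy|lt_yx|E] := ltgtP (x ord0 i) (y ord0 i).
  - by exists (fun p => p ord0 i) => //; exact: sim_proj.
  - exists (fun p => 1 - p ord0 i); first exact/sim_onem/sim_proj.
    by rewrite ltrD2l ltrN2.
  - by rewrite E eqxx in xyi.
have /andP[gx0 _] := sim_range sg cx; have /andP[_ gy1] := sim_range sg cy.
pose s := (2 * g x + g y) / 3; pose r := (g x + 2 * g y) / 3.
have gxs : g x < s by rewrite /s; lra.
have rgy : r < g y by rewrite /r; lra.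
exists [set p | g p < s], [set p | r < g p]; split.
- exact: (cvgr_lt _ (sim_cvg (p := x) sg) _ gxs).
- exact: (cvgr_gt _ (sim_cvg (p := y) sg) _ rgy).
move=> e e0.
have s0 : 0 < s by rewrite /s; lra.
have sr : s < r by rewrite /s /r; lra.
have r1 : r < 1 by lra.
have [T sT HT] := sim_threshold sg s0 sr r1 e0.
by exists T => // p /HT[H1 H2]; split=> gp; [apply: H1|apply: H2]; exact: ltW.
Qed.

(** Two compactness arguments, as in the Stone-Weierstrass theorem. For fixed [y], products of coins
    handle all points with [f <= 1/4]; then the products of complements, complemented, handle all
    [y] with [f y >= 3/4]. Each union halves the error, so [e] stays quantified inside both
    properties. *)
Lemma sim_separation f e : {within cube (R:=R) (n:=n), continuous f} -> 0 < e ->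
  exists2 T, sim T & forall p, cube p ->
    (f p <= 1/4 -> T p <= e) /\ (3/4 <= f p -> 1 - e <= T p).
Proof.
move=> /within_cubeP cf e0.
have near_lt x z : cube x -> f x < z -> \forall q \near nbhs x, cube q -> f q < z.
  move=> cx xz; have zx : 0 < z - f x by lra.
  apply: filterS (cf x cx _ zx) => q H /H; rewrite ltr_norml; lra.
have near_gt x z : cube x -> z < f x -> \forall q \near nbhs x, cube q -> z < f q.
  move=> cx xz; have zx : 0 < f x - z by lra.
  apply: filterS (cf x cx _ zx) => q H /H; rewrite ltr_norml; lra.
have one_point y : cube y -> 3/4 <= f y -> exists2 V, nbhs y V &
    forall e, 0 < e -> exists2 T, sim T & forall p, cube p ->
      (f p <= 1/4 -> T p <= e) /\ (V p -> 1 - e <= T p).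
  move=> cy fy.
  have [||||U cubeU [V yV HV]] := @compact_local_to_global _ (@cube R n)
    (fun U => exists2 V, nbhs y V & forall e, 0 < e -> exists2 T, sim T &
      forall p, cube p ->
        (U p -> f p <= 1/4 -> T p <= e) /\ (V p -> 1 - e <= T p)).
  - exact: compact_cube.
  - exists setT; first exact: filterT.
    move=> e' e'0; exists (fun=> true%:R); first exact: sim_out.
    by move=> p _; split=> //= _; lra.
  - move=> U1 U2 [V1 yV1 H1] [V2 yV2 H2]; exists (V1 `&` V2); first exact: filterI.
    move=> e' e'0; have e'20 : 0 < e' / 2 by lra.
    have [T1 sT1 HT1] := H1 _ e'20; have [T2 sT2 HT2] := H2 _ e'20.
    exists (fun p => T1 p * T2 p); first exact: sim_mul.
    move=> p cp; have [A1 B1] := HT1 p cp; have [A2 B2] := HT2 p cp.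
    have := sim_range sT1 cp; have := sim_range sT2 cp.
    move=> /andP[? ?] /andP[? ?]; split.
      by move=> [/A1|/A2] H /H ?; nra.
    by move=> [/B1 ? /B2 ?]; nra.
  - move=> x cx; have [fx|fx] := leP (f x) (1/4); last first.
      exists [set q | cube q -> 1/4 < f q]; first exact: near_gt.
      exists setT; first exact: filterT.
      move=> e' e'0; exists (fun=> true%:R); first exact: sim_out.
      move=> p cp; split=> /=; last by lra.
      by move=> /(_ cp) ? ?; lra.
    have xy : x <> y by move=> E; rewrite E in fx; lra.
    have [U [V [xU yV H]]] := sim_separate_points cx cy xy.
    exists U => //; exists V => // e' /H[T sT HT]; exists T => // p cp.
    by have [A B] := HT p cp; split => // /A.
  exists V => // e' /HV[T sT HT]; exists T => // p cp.
  by have [A B] := HT p cp; split => //; exact/A/cubeU.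
have [||||V cubeV HV] := @compact_local_to_global _ (@cube R n)
  (fun V => forall e, 0 < e -> exists2 T, sim T & forall p, cube p ->
     (f p <= 1/4 -> T p <= e) /\ (V p -> 3/4 <= f p -> 1 - e <= T p)).
- exact: compact_cube.
- move=> e' e'0; exists (fun=> false%:R); first exact: sim_out.
  by move=> p _; split=> //= _; lra.
- move=> V1 V2 H1 H2 e' e'0; have e'20 : 0 < e' / 2 by lra.
  have [T1 sT1 HT1] := H1 _ e'20; have [T2 sT2 HT2] := H2 _ e'20.
  exists (fun p => 1 - (1 - T1 p) * (1 - T2 p)).
    by apply: sim_onem; apply: sim_mul; exact: sim_onem.
  move=> p cp; have [A1 B1] := HT1 p cp; have [A2 B2] := HT2 p cp.
  have := sim_range sT1 cp; have := sim_range sT2 cp.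
  move=> /andP[? ?] /andP[? ?]; split.
    by move=> H; have := A1 H; have := A2 H; nra.
  by move=> [/B1|/B2] H /H ?; nra.
- move=> y cy; have [fy|fy] := leP (3/4) (f y); last first.
    exists [set q | cube q -> f q < 3/4]; first exact: near_lt.
    move=> e' e'0; exists (fun=> false%:R); first exact: sim_out.
    move=> p cp; split=> /=; first by lra.
    by move=> /(_ cp) ? ?; lra.
  have [V yV H] := one_point y cy fy.
  exists V => // e' /H[T sT HT]; exists T => // p cp.
  by have [A B] := HT p cp; split => // /B.
have [T sT HT] := HV e e0; exists T => // p cp.
by have [A B] := HT p cp; split => //; exact/B/cubeV.
Qed.

(** Compactness again: a point with [f > 1/4] has a neighbourhood on which nothing is required. *)
Lemma sim_positive_lower_bound f g :
  {within cube (R:=R) (n:=n), continuous f} -> sim g ->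
  (forall p, cube p -> f p <= 1/4 -> 0 < g p) ->
  exists2 b, 0 < b & forall p, cube p -> f p <= 1/4 -> b <= g p.
Proof.
move=> /within_cubeP cf sg g0.
have [||||V cubeV [b b0 Hb]] := @compact_local_to_global _ (@cube R n)
  (fun V => exists2 b, 0 < b & forall p, cube p -> V p -> f p <= 1/4 -> b <= g p).
- exact: compact_cube.
- by exists 1.
- move=> V1 V2 [b1 b10 H1] [b2 b20 H2]; exists (Num.min b1 b2).
    by rewrite lt_min b10.
  by move=> p cp [/(H1 p cp)|/(H2 p cp)] H /H; rewrite ge_min => ->; rewrite ?orbT.
- move=> x cx; have [fx|fx] := leP (f x) (1/4).
    have gx := g0 x cx fx.
    exists [set p | g x / 2 < g p].
      by apply: (cvgr_gt _ (sim_cvg (p := x) sg)); lra.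
    by exists (g x / 2) => [|p _ /ltW//]; lra.
  exists [set q | cube q -> 1/4 < f q].
    have fx0 : 0 < f x - 1/4 by lra.
    by apply: filterS (cf x cx _ fx0) => q H /H; rewrite ltr_norml; lra.
  by exists 1 => // p cp /(_ cp) ? ?; lra.
by exists b => // p cp; apply: Hb => //; exact: cubeV.
Qed.

End Separation.

(** * A die that guesses the position of one coin *)

Section Dice.
Variable R : realType.
Implicit Types (x : R) (o : option bool).

(** The probability that none of [m] rounds of [m] flips shows only ones: of order [(1 - x) ^+ m]
    near 1, while its complement is of order [x ^+ m] near 0. *)
Definition all_fail m x : R := (1 - x ^+ m) ^+ m.

(* A three-sided die, simulated by flipping the coin [x], that guesses whether
   [x] is 0, 1 or in between; [die_le] is the point of its design. *)
Definition die m o x : R :=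
  match o with
  | Some false => all_fail m x
  | Some true => (1 - all_fail m x) * all_fail m (1 - x)
  | None => (1 - all_fail m x) * (1 - all_fail m (1 - x))
  end.

Lemma all_fail_range m x : 0 <= x <= 1 -> 0 <= all_fail m x <= 1.
Proof.
move=> /andP[x0 x1]; have : 0 <= 1 - x ^+ m <= 1.
  by rewrite subr_ge0 exprn_ile1// lerBlDr lerDl exprn_ge0.
by move=> /andP[? ?]; rewrite /all_fail exprn_ge0 ?exprn_ile1.
Qed.

Lemma all_fail_le m x : 0 <= x <= 1 -> all_fail m x <= (m ^ m)%:R * (1 - x) ^+ m.
Proof.
move=> /andP[x0 x1]; rewrite natrX -exprMn; apply: lerXn2r.
- by rewrite nnegrE subr_ge0 exprn_ile1.
- by rewrite nnegrE mulr_ge0// subr_ge0.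
have := @bernoulli_le R (1 - x) m; rewrite subKr => H.
have {}H : 1 - m%:R * (1 - x) <= x ^+ m by apply: H; lra.
lra.
Qed.

Lemma onem_all_fail_le m x : 0 <= x <= 1 -> 1 - all_fail m x <= m%:R * x ^+ m.
Proof.
move=> /andP[x0 x1]; have := @bernoulli_le R (x ^+ m) m.
rewrite exprn_ge0// exprn_ile1// => /(_ isT); rewrite /all_fail; lra.
Qed.

Lemma die_ge0 m o x : 0 <= x <= 1 -> 0 <= die m o x.
Proof.
move=> x01; have x01' : 0 <= 1 - x <= 1 by lra.
have /andP[? ?] := all_fail_range m x01.
have /andP[? ?] := all_fail_range m x01'.
by case: o => [[]|] //=; rewrite mulr_ge0// subr_ge0.
Qed.

Definition die_bound m : R := (m ^ m)%:R + m%:R * m%:R.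

Lemma die_bound_ge0 m : 0 <= die_bound m.
Proof. by rewrite addr_ge0// mulr_ge0. Qed.

(** The guesses 0 and 1 each contain one [all_fail] factor, which supplies the power; the guess in
    between multiplies two complements, one for each end. *)
Lemma die_le m o x : 0 <= x <= 1 -> die m o x <= die_bound m * mu o x ^+ m.
Proof.
move=> x01; have x01' : 0 <= 1 - x <= 1 by lra.
have /andP[a0 a1] := all_fail_range m x01.
have /andP[b0 b1] := all_fail_range m x01'.
have A := all_fail_le m x01; have B := all_fail_le m x01'.
have A' := onem_all_fail_le m x01; have B' := onem_all_fail_le m x01'.
have mm0 : 0 <= (m ^ m)%:R :> R by [].
have m0 : 0 <= m%:R * m%:R :> R by rewrite mulr_ge0.
have X0 : 0 <= x ^+ m by rewrite exprn_ge0//; lra.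
have Y0 : 0 <= (1 - x) ^+ m by rewrite exprn_ge0//; lra.
have := mulr_ge0 m0 X0; have := mulr_ge0 m0 Y0.
rewrite subKr in B; rewrite /die_bound; case: o => [[]|] /=.
- move=> _ ?; have : (1 - all_fail m x) * all_fail m (1 - x) <= all_fail m (1 - x).
    by rewrite ler_piMl//; lra.
  lra.
- lra.
move=> _ _; rewrite exprMn.
have H : (1 - all_fail m x) * (1 - all_fail m (1 - x)) <=
    (m%:R * x ^+ m) * (m%:R * (1 - x) ^+ m) by apply: ler_pM => //; lra.
apply: (le_trans H); rewrite mulrACA; apply: ler_wpM2r; first exact: mulr_ge0.
by rewrite lerDr.
Qed.

Lemma die_gt0 m o x : (0 < m)%N -> cell o x -> 0 < die m o x.
Proof.
case: m => // m _; case: o => [[]|] /=.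
- by move=> ->; rewrite /all_fail subrr expr0n expr1n subrr expr0n /= subr0 expr1n; lra.
- by move=> ->; rewrite /all_fail expr0n subr0 expr1n.
move=> /andP[x0 x1].
have lt1 y : 0 < y -> y < 1 -> 0 < 1 - all_fail m.+1 y.
  move=> y0 y1; rewrite subr_gt0 /all_fail.
  have y1' : y ^+ m.+1 < 1 by rewrite exprn_ilt1// ltW.
  have y0' : 0 < y ^+ m.+1 by rewrite exprn_gt0.
  by rewrite exprn_ilt1//; lra.
by apply: mulr_gt0; apply: lt1; lra.
Qed.

End Dice.

Arguments die {R} m o x : simpl never.

(** * Guessing a face with one die per coin *)

Section RandomFace.
Variables (R : realType) (n m : nat).
Implicit Types (f g : 'rV[R]_n -> R) (p : 'rV[R]_n) (s : seq 'I_n)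
  (tau : 'I_n -> option bool) (V W P : ('I_n -> option bool) -> bool).

Definition upd tau i o : 'I_n -> option bool :=
  fun j => if j == i then o else tau j.

(** [h] is the continuation run on the completed guess; coordinates outside [s] keep their value in
    [tau]. *)
Fixpoint draw s (h : ('I_n -> option bool) -> 'rV[R]_n -> R) tau p : R :=
  if s is i :: s' then
    die m (Some false) (p ord0 i) * draw s' h (upd tau i (Some false)) p +
    die m (Some true) (p ord0 i) * draw s' h (upd tau i (Some true)) p +
    die m None (p ord0 i) * draw s' h (upd tau i None) p
  else h tau p.

Definition prob s P := draw s (fun tau _ => (P tau)%:R).

Lemma sim_draw s h tau : (forall tau, sim (h tau)) -> sim (draw s h tau).
Proof.
move=> sh; elim: s tau => [|i s IH] tau //=.
have sA : sim (fun p => all_fail m (p ord0 i)).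
  exact/sim_exp/sim_onem/sim_exp/sim_proj.
have sB : sim (fun p => all_fail m (1 - p ord0 i)).
  exact/sim_exp/sim_onem/sim_exp/sim_onem/sim_proj.
have := sim_ite sA (IH (upd tau i (Some false)))
  (sim_ite sB (IH (upd tau i (Some true))) (IH (upd tau i None))).
by congr sim; apply/funext => p; rewrite /die /=; ring.
Qed.

Lemma sim_prob s P tau : sim (prob s P tau).
Proof. by apply: sim_draw => tau'; exact: sim_out. Qed.

Lemma prob_ge0 s P tau p : cube p -> 0 <= prob s P tau p.
Proof. by move=> cp; have /andP[] := sim_range (sim_prob s P tau) cp. Qed.

Lemma prob_negb s P tau p :
  prob s (fun tau => ~~ P tau) tau p = 1 - prob s P tau p.
Proof.
rewrite /prob; elim: s tau => [|i s IH] tau /=.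
  by case: (P tau) => /=; ring.
by rewrite !IH /die; ring.
Qed.

Lemma le_prob s P P' tau p : cube p -> (forall tau, P tau -> P' tau) ->
  prob s P tau p <= prob s P' tau p.
Proof.
move=> cp PP'; rewrite /prob; elim: s tau => [|i s IH] tau /=.
  by have := PP' tau; case: (P tau) => [->//|_]; case: (P' tau).
by do !apply: lerD; apply: ler_wpM2l => //; apply: die_ge0; exact: cp.
Qed.

(** [V] and [W] never fail together, so the last coefficient is the probability that both hold. *)
Lemma draw_split s V W tau p (h1 h2 h3 : 'rV[R]_n -> R) :
  (forall tau, V tau || W tau) ->
  draw s (fun tau => if ~~ W tau then h1 else if ~~ V tau then h2 else h3) tau p =
  prob s (fun tau => ~~ W tau) tau p * h1 p
  + prob s (fun tau => ~~ V tau) tau p * h2 p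
  + (1 - prob s (fun tau => ~~ W tau) tau p - prob s (fun tau => ~~ V tau) tau p)
    * h3 p.
Proof.
move=> VW; rewrite /prob; elim: s tau => [|i s IH] tau /=.
  by have := VW tau; case: (W tau); case: (V tau) => //= _; ring.
by rewrite !IH /die; ring.
Qed.

(** A union bound over the [3 ^ size s] guesses. The product over coordinates outside [s] carries
    the bounds of the guesses already made, so that the induction closes. *)
Lemma prob_le s P tau p (K : R) : cube p -> uniq s -> 0 <= K ->
  (forall tau, P tau -> \prod_i (die_bound R m * mu (tau i) (p ord0 i) ^+ m) <= K) ->
  prob s P tau p * \prod_(i | i \notin s)
    (die_bound R m * mu (tau i) (p ord0 i) ^+ m) <= (3 ^ size s)%:R * K.
Proof.
move=> cp us K0 HP; rewrite /prob.
have F0 o i : 0 <= die_bound R m * mu o (p ord0 i) ^+ m.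
  have /andP[mu0 _] := mu_range o (cp i).
  by rewrite mulr_ge0 ?die_bound_ge0 ?exprn_ge0.
elim: s us tau => [_|i s IH /andP[iNs us]] tau.
  rewrite /= mul1r; case E: (P tau); last by rewrite mul0r.
  by rewrite mul1r; exact: HP.
set X := \prod_(_ | _) _.
have X0 : 0 <= X by apply: prodr_ge0.
have step o : die m o (p ord0 i) * prob s P (upd tau i o) p * X <=
    (3 ^ size s)%:R * K.
  apply: le_trans (IH us (upd tau i o)).
  rewrite (bigD1 i)//=; have -> : upd tau i o i = o by rewrite /upd eqxx.
  have -> : \prod_(j | (j \notin s) && (j != i))
      (die_bound R m * mu (upd tau i o j) (p ord0 j) ^+ m) = X.
    apply: eq_big => j; first by rewrite in_cons negb_or andbC.
    by rewrite /upd => /andP[_ /negPf->].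
  rewrite mulrA; apply: ler_wpM2r => //; rewrite mulrC; apply: ler_wpM2l.
    exact: prob_ge0.
  exact: die_le.
have -> : (3 ^ size (i :: s))%:R * K =
    (3 ^ size s)%:R * K + (3 ^ size s)%:R * K + (3 ^ size s)%:R * K :> R.
  by rewrite /= expnS natrM; ring.
rewrite /= !mulrDl; do !apply: lerD; exact: step.
Qed.

(** Every die may guess right, so the branch leading to [tau0] has positive probability. *)
Lemma prob_gt0 s P tau tau0 p : (0 < m)%N -> on_face tau0 p -> P tau0 ->
  (forall i, i \notin s -> tau i = tau0 i) -> 0 < prob s P tau p.
Proof.
move=> m0 pt P0; have cp := on_face_cube pt; rewrite /prob.
elim: s tau => [|i s IH] tau /= Htau.
  have -> : tau = tau0 by apply/funext => i; exact: Htau.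
  by rewrite P0.
have Hi : 0 < die m (tau0 i) (p ord0 i) * prob s P (upd tau i (tau0 i)) p.
  rewrite mulr_gt0 ?die_gt0//; apply: IH => j js; rewrite /upd.
  by case: eqP => [-> // | /eqP ji]; apply: Htau; rewrite in_cons negb_or ji.
have H o : 0 <= die m o (p ord0 i) * prob s P (upd tau i o) p.
  by rewrite mulr_ge0 ?die_ge0 ?prob_ge0.
have := H (Some false); have := H (Some true); have := H None; move: Hi.
by rewrite /prob; case: (tau0 i) => [[]|]; lra.
Qed.

End RandomFace.

(** * A finite factory comparable to [f] and, complemented, to [1 - f] *)

Section KeyApproximation.
Variables (R : realType) (n : nat).
Implicit Types (f g h : 'rV[R]_n -> R) (p : 'rV[R]_n)
  (tau : 'I_n -> option bool) (P : ('I_n -> option bool) -> bool).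

Definition face_nonzero f tau : bool :=
  `[< exists p, on_face tau p /\ f p <> 0 >].

Lemma on_face_exists tau : exists p : 'rV[R]_n, on_face tau p.
Proof.
exists (\row_i (if tau i is Some b then b%:R else 1/2)) => i.
by rewrite mxE; case: (tau i) => [[]|] //=; lra.
Qed.

Lemma face_of_point p : cube p -> exists tau, on_face tau p.
Proof.
move=> cp; exists (fun i => if p ord0 i == 0 then Some false
                            else if p ord0 i == 1 then Some true else None).
move=> i; case: eqP => [//|/eqP p0] /=; case: eqP => [//|/eqP p1] /=.
by rewrite !lt_neqAle eq_sym p0 p1 /=; exact: cp.
Qed.

(** A counted guess has probability at most [D ^+ n * mono tau p ^+ m], and [mono tau p ^+ m] is at
    most [f p / c]. *)
Lemma prob_face_nonzero_le f m c : 0 < c -> face_bounded m c f ->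
  exists2 C, 0 <= C & forall p, cube p -> 0 <= f p ->
    prob m (enum 'I_n) (face_nonzero f) (fun=> None) p <= C * f p.
Proof.
move=> c0 fb; exists ((3 ^ n)%:R * (die_bound R m ^+ n / c)).
  by rewrite mulr_ge0// divr_ge0 ?exprn_ge0 ?die_bound_ge0// ltW.
move=> p cp fp0; set D := die_bound R m.
have D0 : 0 <= D := die_bound_ge0 R m.
have K0 : 0 <= D ^+ n / c * f p by rewrite mulr_ge0// divr_ge0 ?exprn_ge0// ltW.
have HP tau : face_nonzero f tau ->
    \prod_i (D * mu (tau i) (p ord0 i) ^+ m) <= D ^+ n / c * f p.
  move=> /asboolP E; rewrite big_split /= prodr_const card_ord -mulrA.
  apply: ler_wpM2l; first exact: exprn_ge0.
  by rewrite prodrXl mulrC ler_pdivlMr// mulrC; exact: fb.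
have := prob_le (fun=> None) cp (enum_uniq 'I_n) K0 HP.
rewrite big_pred0; last by move=> i; rewrite mem_enum.
by rewrite mulr1 size_enum_ord mulrA.
Qed.

Lemma prob_face_nonzero_gt0 f m p : (0 < m)%N -> cube p -> f p <> 0 ->
  0 < prob m (enum 'I_n) (face_nonzero f) (fun=> None) p.
Proof.
move=> m0 cp fp; have [tau pt] := face_of_point cp.
apply: (prob_gt0 m0 pt); first by apply/asboolP; exists p.
by move=> i; rewrite mem_enum.
Qed.

(* [P] and [P'] stand for [f] and [1 - f] not vanishing on the guessed face, so
   [a] and [b] are the probabilities that only [P], resp. only [P'], holds.
   Draw [L.+1] faces: output 1 (resp. 0) if all are of the first (resp. second)
   kind, and flip the coin [T] otherwise. *)
Lemma sim_unanimous m P P' L T : sim T -> (forall tau, P tau || P' tau) ->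
  let a := prob m (enum 'I_n) (fun tau => ~~ P' tau) (fun=> None) in
  let b := prob m (enum 'I_n) (fun tau => ~~ P tau) (fun=> None) in
  @sim R n (fun p => a p ^+ L.+1 + (1 - a p ^+ L.+1 - b p ^+ L.+1) * T p).
Proof.
move=> sT PP' a b.
have split3 h1 h2 h3 : sim h1 -> sim h2 -> sim h3 ->
    sim (fun p => a p * h1 p + b p * h2 p + (1 - a p - b p) * h3 p).
  move=> s1 s2 s3.
  have := @sim_draw R n m (enum 'I_n)
    (fun tau => if ~~ P' tau then h1 else if ~~ P tau then h2 else h3)
    (fun=> None).
  have H tau : sim (if ~~ P' tau then h1 else if ~~ P tau then h2 else h3).
    by case: ifP => // _; case: ifP.
  move=> /(_ H){}H.
  by move: H; congr sim; apply/funext => p; exact: draw_split.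
(* [simQ k] and [simR k] are the states in which [k] draws remain and all earlier ones were of the
   first, resp. second, kind. *)
have simQ k : sim (fun p => a p ^+ k + (1 - a p ^+ k) * T p).
  elim: k => [|k IH].
    by have := sim_out R n true; congr sim; apply/funext => p /=; rewrite expr0; ring.
  have := split3 _ _ _ IH sT sT; congr sim.
  by apply/funext => p; rewrite exprS; ring.
have simR k : sim (fun p => (1 - b p ^+ k) * T p).
  elim: k => [|k IH].
    by have := sim_out R n false; congr sim; apply/funext => p /=; rewrite expr0; ring.
  have := split3 _ _ _ sT IH sT; congr sim.
  by apply/funext => p; rewrite exprS; ring.
have := split3 _ _ _ (simQ L) (simR L) sT; congr sim.
by apply/funext => p; rewrite !exprS; ring.
Qed.

(** Unanimity for 1 contributes [a * a ^+ L <= C * x * (1 - be) ^+ L <= 2 * x]. The coin is flipped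
    only if some draw is not of the second kind, of probability at most [L.+1%:R * (C * x)], and
    then shows 1 with probability at most [eta]: again at most [2 * x]. *)
Lemma unanimous_le (a b t x be C eta : R) L :
  0 <= a -> 0 <= b -> a + b <= 1 -> 0 <= t <= eta -> 0 <= x -> 0 <= C ->
  a <= C * x -> 1 - b <= C * x -> a <= 1 - be -> be <= 1 ->
  C * (1 - be) ^+ L <= 2 -> L.+1%:R * C * eta <= 2 ->
  a ^+ L.+1 + (1 - a ^+ L.+1 - b ^+ L.+1) * t <= 4 * x.
Proof.
move=> a0 b0 ab /andP[t0 teta] x0 C0 aC bC abe be1 HL Heta.
have Ha : a ^+ L.+1 <= 2 * x.
  rewrite exprS; apply: (@le_trans _ _ (C * x * (1 - be) ^+ L)).
    apply: ler_pM; rewrite ?exprn_ge0//.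
    by apply: lerXn2r; rewrite ?nnegrE//; lra.
  by rewrite mulrAC ler_wpM2r.
have aL0 : 0 <= a ^+ L.+1 by rewrite exprn_ge0.
have Hb : 1 - b ^+ L.+1 <= L.+1%:R * (C * x).
  have : 0 <= 1 - b <= 1 by lra.
  move=> /(bernoulli_le L.+1); rewrite subKr.
  have : L.+1%:R * (1 - b) <= L.+1%:R * (C * x) by apply: ler_wpM2l.
  lra.
have : (1 - a ^+ L.+1 - b ^+ L.+1) * t <= 2 * x.
  apply: (@le_trans _ _ (L.+1%:R * (C * x) * t)).
    by apply: ler_wpM2r => //; lra.
  apply: (@le_trans _ _ (L.+1%:R * (C * x) * eta)).
    by apply: ler_wpM2l; rewrite ?mulr_ge0.
  by have := ler_wpM2r x0 Heta; lra.
lra.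
Qed.

Lemma key_approximation f m c : (0 < m)%N -> 0 < c ->
  {within cube (R:=R) (n:=n), continuous f} ->
  (forall p, cube p -> 0 <= f p <= 1) ->
  face_bounded m c f -> face_bounded m c (fun p => 1 - f p) ->
  exists2 g, sim g &
    forall p, cube p -> g p <= 4 * f p /\ 1 - g p <= 4 * (1 - f p).
Proof.
move=> m0 c0 cf f01 fb fb'.
pose f' p := 1 - f p.
pose P := face_nonzero f; pose P' := face_nonzero f'.
have PP' tau : P tau || P' tau.
  have [p pt] := on_face_exists tau; apply/orP.
  have [fp|fp] := pselect (f p <> 0); first by left; apply/asboolP; exists p.
  right; apply/asboolP; exists p; split => //.
  by rewrite /f' (contrapT fp) subr0; exact/eqP/oner_neq0.
pose v := prob m (enum 'I_n) P (fun=> None) : 'rV[R]_n -> R.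
pose w := prob m (enum 'I_n) P' (fun=> None) : 'rV[R]_n -> R.
pose a := prob m (enum 'I_n) (fun tau => ~~ P' tau) (fun=> None) : 'rV[R]_n -> R.
pose b := prob m (enum 'I_n) (fun tau => ~~ P tau) (fun=> None) : 'rV[R]_n -> R.
have aE p : a p = 1 - w p by exact: prob_negb.
have bE p : b p = 1 - v p by exact: prob_negb.
have [C1 C10 HC1] := prob_face_nonzero_le c0 fb.
have [C2 C20 HC2] := prob_face_nonzero_le c0 fb'.
have cf' : {within cube (R:=R) (n:=n), continuous f'}.
  move/within_cubeP: cf => cf; apply/within_cubeP => p cp e e0.
  apply: filterS (cf p cp e e0) => q H /H; rewrite /f'.
  have -> : 1 - f p - (1 - f q) = - (f p - f q) by ring.
  by rewrite normrN.
(* Where [f <= 1/4], [1 - f] is nonzero, so the correct guess counts for [w]. A uniform lower bound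
   on [w] keeps [a = 1 - w] away from 1. *)
have [b1 b10 Hb1] : exists2 b, 0 < b & forall p, cube p -> f p <= 1/4 -> b <= w p.
  apply: sim_positive_lower_bound cf (sim_prob _ _ _ _ _) _ => p cp fp.
  by apply: prob_face_nonzero_gt0; rewrite // /f'; lra.
have [b2 b20 Hb2] : exists2 b, 0 < b & forall p, cube p -> f' p <= 1/4 -> b <= v p.
  apply: sim_positive_lower_bound cf' (sim_prob _ _ _ _ _) _ => p cp fp.
  by apply: prob_face_nonzero_gt0; rewrite // /f' in fp *; lra.
pose be := Num.min 1 (Num.min b1 b2).
have be0 : 0 < be by rewrite !lt_min ltr01 b10 b20.
have be1 : be <= 1 by rewrite ge_min lexx.
have beb1 : be <= b1 by rewrite !ge_min lexx orbT.
have beb2 : be <= b2 by rewrite !ge_min lexx !orbT.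
pose C := C1 + C2 + 1; have C0 : 0 < C by rewrite /C; lra.
have [L HL] : exists L, (1 - be) ^+ L <= 2 / C.
  by apply: expr_small; [apply/andP; split; lra|rewrite divr_gt0].
have {}HL : C * (1 - be) ^+ L <= 2 by rewrite mulrC -ler_pdivlMr.
(* The number of draws is fixed first; the accuracy of [T] is then adapted to it. *)
pose eta := 2 / (L.+1%:R * C).
have eta0 : 0 < eta by rewrite divr_gt0// mulr_gt0.
have Heta : L.+1%:R * C * eta <= 2 by rewrite mulrCA mulfV ?mulr1// mulf_neq0// gt_eqF.
have [T sT HT] := sim_separation cf eta0.
have sg := sim_unanimous m L sT PP'.
exists (fun p => a p ^+ L.+1 + (1 - a p ^+ L.+1 - b p ^+ L.+1) * T p) => //.
move=> p cp; have := f01 p cp => /andP[f0 f1].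
have /andP[g0 g1] := sim_range sg cp.
have a0 : 0 <= a p by exact: prob_ge0.
have b0 : 0 <= b p by exact: prob_ge0.
have ab : a p + b p <= 1.
  have : a p <= v p.
    by apply: le_prob => // tau; have := PP' tau; case: (P tau); case: (P' tau).
  by rewrite bE; lra.
have vC : v p <= C * f p.
  apply: le_trans (HC1 p cp f0) _; apply: ler_wpM2r => //; rewrite /C; lra.
have wC : w p <= C * f' p.
  have f'0 : 0 <= f' p by rewrite /f'; lra.
  apply: le_trans (HC2 p cp f'0) _; apply: ler_wpM2r => //; rewrite /C; lra.
have [T1 T2] := HT p cp; have /andP[T0 T11] := sim_range sT cp.
split.
  (* Above 1/4 the bound [4 * f p] exceeds 1 and is trivial. *)
  have [fp|fp] := leP (f p) (1/4); last first.
    by apply: le_trans g1 _; lra.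
  apply: (@unanimous_le _ _ _ _ be C eta) => //.
  - by rewrite T0 T1.
  - exact: ltW.
  - by move: ab vC; rewrite bE; lra.
  - by rewrite bE; lra.
  - by rewrite aE; have := Hb1 p cp fp; lra.
have [fp|fp] := leP (f' p) (1/4); last first.
  by apply: (@le_trans _ _ 1); [lra|move: fp; rewrite /f'; lra].
(* Exchanging the outputs swaps [a] with [b] and [T] with [1 - T], so the same estimate serves
   [1 - f]. *)
have -> : 1 - (a p ^+ L.+1 + (1 - a p ^+ L.+1 - b p ^+ L.+1) * T p) =
  b p ^+ L.+1 + (1 - b p ^+ L.+1 - a p ^+ L.+1) * (1 - T p) by ring.
have fp' : 3/4 <= f p by move: fp; rewrite /f'; lra.
have T2' := T2 fp'.
apply: (@unanimous_le _ _ _ _ be C eta) => //.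
- by rewrite addrC.
- by apply/andP; split; lra.
- by lra.
- exact: ltW.
- by move: ab wC; rewrite aE /f'; lra.
- by move: wC; rewrite aE /f'; lra.
- by rewrite bE; have := Hb2 p cp fp; lra.
Qed.

End KeyApproximation.

(** * Sufficiency: iterating the residual *)

Section Sufficiency.
Variables (R : realType) (n m : nat).
Implicit Types (f g : 'rV[R]_n -> R) (p : 'rV[R]_n).

(** The constant [c] is existential because each residual shrinks it by [4 / 7]; the exponent [m] is
    preserved. *)
Definition factory_ready f : Prop :=
  [/\ {within cube (R:=R) (n:=n), continuous f},
      forall p, cube p -> 0 <= f p <= 1 &
      exists c, [/\ 0 < c, face_bounded m c f &
                    face_bounded m c (fun p => 1 - f p)]].

(* The solution [f'] of [f = g / 8 + 7 f' / 8]. *)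
Definition residual f g p : R := (8 * f p - g p) / 7.

Lemma residual_onem f g :
  (fun p => 1 - residual f g p) = residual (fun p => 1 - f p) (fun p => 1 - g p).
Proof. by apply/funext => p; rewrite /residual; field. Qed.

(** From [g <= 4 f] the residual is at least [4 f / 7], and it vanishes wherever [f] does, so no
    further face imposes a condition. *)
Lemma face_bounded_residual c f g :
  (forall p, cube p -> 0 <= f p) -> (forall p, cube p -> 0 <= g p <= 4 * f p) ->
  face_bounded m c f -> face_bounded m (4 / 7 * c) (residual f g).
Proof.
move=> f0 g0 fb tau [p0 [p0t r0]] p cp.
have fp : c * mono tau p ^+ m <= f p.
  apply: fb => //; exists p0; split => // E; apply: r0.
  have := g0 p0 (on_face_cube p0t); rewrite /residual E => /andP[? ?]; lra.
by have /andP[_] := g0 p cp; rewrite /residual; lra.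
Qed.

Lemma factory_ready_residual f g : factory_ready f -> sim g ->
  (forall p, cube p -> g p <= 4 * f p /\ 1 - g p <= 4 * (1 - f p)) ->
  factory_ready (residual f g).
Proof.
move=> [/within_cubeP cf f01 [c [c0 fb fb']]] sg gf; split.
- apply/within_cubeP => p cp e e0.
  have e20 : 0 < e / 2 by lra.
  have /cvgrPdist_lt/(_ _ e20) cg := sim_cvg (p := p) sg.
  apply: filterS2 (cf p cp _ e20) cg => q cfq cgq /cfq {cfq}.
  by move: cgq; rewrite /residual !ltr_norml => /andP[? ?] /andP[? ?]; lra.
- move=> p cp; have := f01 p cp; have := gf p cp => -[? ?].
  by rewrite /residual; lra.
exists (4 / 7 * c); split; first lra.
  apply: face_bounded_residual => // p cp; first by have /andP[] := f01 p cp.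
  by have /andP[-> _] := sim_range sg cp; have [-> _] := gf p cp.
rewrite residual_onem; apply: face_bounded_residual => // p cp.
  by have := f01 p cp; lra.
by have := sim_range sg cp; have := gf p cp; lra.
Qed.

Lemma factory_ready_implementable f :
  (0 < m)%N -> factory_ready f -> implementable f.
Proof.
move=> m0 rf.
(* Stated for every [h] so that [choice] applies; the witness for an unready [h] is a dummy. *)
have approx h : exists g, factory_ready h -> sim g /\
    forall p, cube p -> g p <= 4 * h p /\ 1 - g p <= 4 * (1 - h p).
  have [[ch h01 [c [c0 hb hb']]]|nh] := pselect (factory_ready h).
    by have [g sg Hg] := key_approximation m0 c0 ch h01 hb hb'; exists g.
  by exists h.
have [G HG] := choice approx.
pose F k := iter k (fun h => residual h (G h)) f.
have rF k : factory_ready (F k).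
  elim: k => [//|k IH]; have [sg Hg] := HG _ IH.
  exact: factory_ready_residual IH sg Hg.
apply: (@implementable_mixture R n (1 / 8) F (fun k => G (F k))).
- by lra.
- by move=> k; have [] := rF k.
- by move=> k; have [/sim_implementable] := HG _ (rF k).
- by move=> k p _; rewrite [F k.+1]/= /residual; field.
Qed.

End Sufficiency.

Theorem theorem1 (R : realType) (n : nat) (f : 'rV[R]_n -> R) :
  (1 <= n)%N ->
  (forall p, cube p -> 0 <= f p <= 1) ->
  (implementable f <->
     [/\ {within cube (R:=R) (n:=n), continuous f},
         poly_bounded f &
         poly_bounded (fun p => 1 - f p)]).
Proof.
move=> _ f01; split.
  move=> /implementableP[t Ht]; split.
  - exact: realizes_continuous Ht.
  - exact: (realizes_poly_bounded true Ht).
  - exact: (realizes_poly_bounded false Ht).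
move=> [cf /poly_boundedP[m1 [c1 [c10 fb1]]] /poly_boundedP[m2 [c2 [c20 fb2]]]].
(* The successor makes the exponent positive: with exponent 0 the die would always answer
   [Some false]. *)
apply: (@factory_ready_implementable R n (maxn m1 m2).+1) => //; split=> //.
exists (Num.min c1 c2); rewrite lt_min c10 c20; split=> //.
  by apply: face_boundedW fb1; rewrite ?leqW ?leq_maxl// lt_min c10 c20 ge_min lexx.
apply: face_boundedW fb2; rewrite ?leqW ?leq_maxr//.
by rewrite lt_min c10 c20 ge_min lexx orbT.
Qed.
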